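(* Let $\Omega\subset\mathbb{R}^2$ be a bounded open set and $s\in(0,1)$. Then $$P_s(\Omega)\le \frac{1}{s(1-s)}C_{1-s}(\Omega).$$ Moreover, if $\Omega=\operatorname{int}K$ for some planar convex body $K$, then equality holds.
   Context: A planar convex body is a compact convex subset of $\mathbb{R}^2$ with nonempty interior; $\operatorname{int}K$ denotes the interior of $K$. Fractional perimeter: $P_s(E):=\int_E\int_{\mathbb{R}^2\setminus E}\frac{dx\,dy}{|x-y|^{2+s}}$ for Borel $E\subset\mathbb{R}^2$. Chord functional: let $\mathbb{S}^1$ be the unit circle with arclength measure $\sigma$ (total mass $2\pi$). For $u\in\mathbb{S}^1$ let $u^\perp:=\{z\in\mathbb{R}^2: z\cdot u=0\}$, with one-dimensional Lebesgue measure $dz$. For a bounded open set $\Omega\subset\mathbb{R}^2$, $u\in\mathbb{S}^1$ and $z\in u^\perp$, let $\Omega_{u,z}:=\{t\in\mathbb{R}: z+tu\in\Omega\}$, an open subset of $\mathbb{R}$, and let $\mathcal{I}(\Omega;u,z)$ be the (countable) family of its interval components. For $q\in(0,1)$, $$C_q(\Omega):=\int_{\mathbb{S}^1}\int_{u^\perp}\sum_{J\in\mathcal{I}(\Omega;u,z)}|J|^q\,dz\,d\sigma(u),$$ where $|J|$ is the length of $J$. *)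

(* Defs.v *)
From HB Require Import structures.
From mathcomp Require Import all_boot all_order all_algebra.
From mathcomp Require Import all_classical all_reals all_analysis.

Set Implicit Arguments.
Unset Strict Implicit.
Unset Printing Implicit Defensive.

Import Order.TTheory GRing.Theory Num.Theory.
Import numFieldNormedType.Exports.

Local Open Scope classical_set_scope.
Local Open Scope ring_scope.

(* R * R carries the max norm in the library: it has the Euclidean topology and
   the same bounded sets, but Euclidean length must be defined separately. *)
Definition dot (R : realType) (u v : R * R) : R := u.1 * v.1 + u.2 * v.2.

Definition enorm (R : realType) (u : R * R) : R := Num.sqrt (dot u u).

Definition lebesgue2 (R : realType) :
    set (measurableTypeR R * measurableTypeR R) -> \bar R :=
  (@lebesgue_measure R \x @lebesgue_measure R)%E.

Definition frac_perimeter (R : realType) (s : R) (E : set (R * R)) : \bar R :=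
  (\int[@lebesgue2 R]_(x in E) \int[@lebesgue2 R]_(y in ~` E)
     (((enorm (x - y)) `^ (2 + s))^-1)%:E)%E.

Definition unit_circle (R : realType) : set (R * R) := [set u | enorm u = 1].

(* Arclength on the unit circle, as a Borel measure on the plane: the image of
   Lebesgue measure on [0, 2 pi[ under the unit-speed parametrization. *)
Definition arclength (R : realType) :
    set (measurableTypeR R * measurableTypeR R) -> \bar R :=
  pushforward
    (mrestr (@lebesgue_measure R) (measurable_itv `[0, 2 * pi[))
    (fun theta : measurableTypeR R =>
       (cos theta, sin theta) : measurableTypeR R * measurableTypeR R).

Definition orthogonal_line (R : realType) (u : R * R) : set (R * R) :=
  [set z | dot z u = 0].

(* For a unit vector u, one-dimensional Lebesgue measure on the line orthogonal
   to u, as a Borel measure on the plane: (- u.2, u.1) is a unit vector spanning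
   this line. *)
Definition orthogonal_line_measure (R : realType) (u : R * R) :
    set (measurableTypeR R * measurableTypeR R) -> \bar R :=
  pushforward (@lebesgue_measure R)
    (fun r : measurableTypeR R =>
       (r * - u.2, r * u.1) : measurableTypeR R * measurableTypeR R).

Definition slice (R : realType) (Omega : set (R * R)) (u z : R * R) : set R :=
  [set t | Omega (z + t *: u)].

Definition interval_components (R : realType) (A : set R) : set (set R) :=
  connected_component A @` A.

Definition chord_functional (R : realType) (q : R) (Omega : set (R * R)) :
    \bar R :=
  (\int[@arclength R]_(u in @unit_circle R)
     \int[orthogonal_line_measure u]_(z in orthogonal_line u)
       \esum_(J in interval_components (slice Omega u z))
         poweR (lebesgue_measure J) q)%E.

Definition planar_convex_body (R : realType) (K : set (R * R)) : Prop :=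
  [/\ compact K, convex_set K & K° !=set0].

(* Main.v *)
Require Import Defs.
From HB Require Import structures.
From mathcomp Require Import all_boot all_order all_algebra.
From mathcomp Require Import all_classical all_reals all_analysis.
From mathcomp Require Import measurable_realfun ring lra.

(** In the double integral that defines the fractional perimeter, put
    y = x + h, take polar coordinates h = r u, and sort the points x by
    the line of direction u that contains them. The perimeter becomes an
    integral over all oriented lines (frac_perimeter_chord_energy). The
    line with trace A on Omega contributes the integral, over t in A and
    over r > 0 such that t + r is not in A, of r ^ (- 1 - s): the factor
    |h| ^ (- 2 - s) has been multiplied by the polar Jacobian r.

    The chord functional is an integral over the same lines, against the
    same measure, so it is enough to compare the integrands on one line.
    If t lies in the component ]a, b[ of A, then t + r can be outside A
    only if r >= b - t; hence the integral over r is at most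
    (b - t) ^ (- s) / s, and integrating over t in ]a, b[ gives
    (b - a) ^ (1 - s) / (s (1 - s)). Summing over the components proves
    the inequality (exit_integral_le_chord_sum). The loss comes only from
    half-lines that leave A and meet it again. There are none when A is an
    interval, and all the slices of the interior of a convex body are
    intervals; this gives the equality (exit_integral_interval and
    slice_interior_convex).

    The contribution of a line to the perimeter is a measurable function
    of the line, by Tonelli's theorem, so that its integral over the lines
    and the circle can be computed in parameters. The passage to the sum
    over the chords uses only that integrals of nonnegative functions are
    monotone (le_integral_ge0). The changes of variables themselves, polar
    coordinates (ge0_integral_polar) and rotations of the plane
    (ge0_integral_rotation), are obtained from two substitutions on the
    line, affine maps (ge0_integral_affine) and the tangent
    (ge0_integral_tan), each being an equality of two measures on
    half-open intervals. *)

Set Implicit Arguments.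
Unset Strict Implicit.
Unset Printing Implicit Defensive.

Import Order.TTheory GRing.Theory Num.Theory.
Import numFieldNormedType.Exports.

Local Open Scope classical_set_scope.
Local Open Scope ring_scope.

(** * Integrals of nonnegative functions *)

Local Notation image_measure :=
  measure_function_pushforward__canonical__measure_function_Measure.

Section nonnegative_integrals.
Context {R : realType}.
Notation mu := (@lebesgue_measure R).
Local Open Scope ereal_scope.
Import HBNNSimple.

(** The integral of a nonnegative function is a supremum over the simple
    functions below it, hence monotone for arbitrary integrands. The larger
    integrand will be the sum over the chords of a line, as a function of
    the line. *)
Lemma le_integral_ge0 d (T : measurableType d) (m : {measure set T -> \bar R})
    (D : set T) (f g : T -> \bar R) :
  (forall x, D x -> 0 <= f x) -> (forall x, D x -> f x <= g x) ->
  \int[m]_(x in D) f x <= \int[m]_(x in D) g x.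
Proof.
move=> f0 fg; have g0 x : D x -> 0 <= g x.
  by move=> Dx; exact: le_trans (f0 _ Dx) (fg _ Dx).
rewrite !ge0_integralE//; apply: le_ereal_sup => _ [h hf <-].
exists h => // x; apply: (le_trans (hf x)).
by apply: lee_restrict => y /fg.
Qed.

Lemma affine_preimage_measure (a b x y : R) : a != 0%R ->
  `|a|%:E * mu ((fun t => (a * t + b)%R) @^-1` `]x, y]%classic) =
  mu `]x, y]%classic.
Proof.
move=> a0; have [xy|yx] := ltP x y; last first.
  rewrite set_itv_ge ?preimage_set0 ?measure0 ?mule0// -leNgt.
  by rewrite bnd_simp.
rewrite lebesgue_measure_itv/= lte_fin xy.
have [an|ap|/eqP] := ltgtP a 0%R; last by rewrite (negbTE a0).
- rewrite (_ : _ @^-1` _ =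
      `[((y - b) / a)%R, ((x - b) / a)%R[%classic); last first.
    apply/seteqP; split=> t /=; rewrite !in_itv/= => /andP[h1 h2];
      apply/andP; split.
    + by rewrite ler_ndivrMr// mulrC; lra.
    + by rewrite ltr_ndivlMr// mulrC; lra.
    + by move: h2; rewrite ltr_ndivlMr// mulrC; lra.
    + by move: h1; rewrite ler_ndivrMr// mulrC; lra.
  rewrite lebesgue_measure_itv/= lte_fin ltr_nM2r ?invr_lt0// ltrD2r xy.
  by rewrite ltr0_norm// -!EFinB -EFinM; congr EFin; field.
- rewrite (_ : _ @^-1` _ =
      `]((x - b) / a)%R, ((y - b) / a)%R]%classic); last first.
    apply/seteqP; split=> t /=; rewrite !in_itv/= => /andP[h1 h2];
      apply/andP; split.
    + by rewrite ltr_pdivrMr// mulrC; lra.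
    + by rewrite ler_pdivlMr// mulrC; lra.
    + by move: h1; rewrite ltr_pdivrMr// mulrC; lra.
    + by move: h2; rewrite ler_pdivlMr// mulrC; lra.
  rewrite lebesgue_measure_itv/= lte_fin ltr_pM2r ?invr_gt0// ltrD2r xy.
  by rewrite gtr0_norm// -!EFinB -EFinM; congr EFin; field.
Qed.

(** The image of Lebesgue measure by t |-> a t + b, scaled by the absolute
    value of a, agrees with Lebesgue measure on the intervals ]x, y], hence
    on Borel sets. *)
Lemma ge0_integral_affine (a b : R) (f : R -> \bar R) : a != 0%R ->
  measurable_fun setT f -> (forall x, 0 <= f x) ->
  \int[mu]_x f x = `|a|%:E * \int[mu]_t f (a * t + b)%R.
Proof.
move=> a0 mf f0.
pose phi : measurableTypeR R -> measurableTypeR R := fun t => (a * t + b)%R.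
have mphi : measurable_fun setT phi.
  by apply: measurable_funD => //; apply: measurable_funM.
pose k : {nonneg R} := NngNum (normr_ge0 a).
pose nu : {measure set (measurableTypeR R) -> \bar R} :=
  image_measure mu mphi.
transitivity (\int[mscale k nu]_x f x).
  apply: eq_measure_integral => //= A mA _.
  apply: lebesgue_measure_unique => // _ [[x y] _ <-].
  by rewrite /= /mscale/= /pushforward affine_preimage_measure.
rewrite ge0_integral_mscale//= ge0_integral_pushforward//.
Qed.

(** Both sides are monotone limits along simple functions, and for these the
    equality reduces by linearity to indicator functions. *)
Lemma ge0_integral_density d (T : measurableType d)
    (m nu : {measure set T -> \bar R}) (w : T -> R) (H : T -> \bar R) :
  measurable_fun setT w -> (forall x, (0 <= w x)%R) ->
  (forall A, measurable A -> nu A = \int[m]_(x in A) (w x)%:E) ->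
  measurable_fun setT H -> (forall x, 0 <= H x) ->
  \int[nu]_x H x = \int[m]_x (H x * (w x)%:E).
Proof.
move=> mw w0 nuE mH H0.
pose h := nnsfun_approx measurableT mH.
have mh n : measurable_fun setT (EFin \o h n).
  exact/measurable_EFinP/measurable_funP.
have hH x : (h n x)%:E @[n --> \oo] --> H x.
  by apply: cvg_nnsfun_approx => // *; exact: H0.
have nd_h x : {homo (fun n => (h n x)%:E) : k n / (k <= n)%N >-> k <= n}.
  by move=> k n kn; rewrite lee_fin; exact/lefP/nd_nnsfun_approx.
have step n : \int[nu]_x (h n x)%:E = \int[m]_x ((h n x)%:E * (w x)%:E).
  under eq_integral do rewrite fimfunE -fsumEFin//.
  under [RHS]eq_integral => x _.
    rewrite fimfunE -fsumEFin// ge0_mule_fsuml; last first.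
      by move=> r; exact: nnfun_muleindic_ge0.
    over.
  have mind r : measurable (h n @^-1` [set r]) by [].
  rewrite !ge0_integral_fsum//=; first last.
  - by move=> r x _; exact: nnfun_muleindic_ge0.
  - by move=> r; exact/measurable_EFinP/measurable_funM.
  - by move=> r x _; rewrite mule_ge0 ?nnfun_muleindic_ge0 ?lee_fin.
  - move=> r; apply: emeasurable_funM; last exact/measurable_EFinP.
    exact/measurable_EFinP/measurable_funM.
  apply: eq_fsbigr => r _.
  rewrite integralZl_indic_nnsfun// integral_indic// setIT.
  rewrite nuE//.
  under [RHS]eq_integral do rewrite EFinM -muleA.
  have [r0|r0] := leP 0%R r; last first.
    by rewrite preimage_nnfun0// integral_set0 mule0 integral0_eq// => x _;
      rewrite indicE in_set0 mul0e mule0.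
  rewrite ge0_integralZl_EFin//; last 2 first.
  - by move=> x _; rewrite mule_ge0// lee_fin.
  - by apply: emeasurable_funM => //; exact/measurable_EFinP.
  congr (_ * _); rewrite [LHS]integral_mkcond; apply: eq_integral => x _.
  by rewrite patchE indicE; case: ifPn; rewrite (mul1e, mul0e).
transitivity (limn (fun n => \int[nu]_x (h n x)%:E)).
  rewrite -monotone_convergence//; last first.
    by move=> n x _; rewrite lee_fin.
  by apply: eq_integral => x _; apply/esym/cvg_lim => //; exact: hH.
under eq_fun do rewrite step.
rewrite -monotone_convergence//; last 3 first.
- by move=> n; apply: emeasurable_funM => //; exact/measurable_EFinP.
- by move=> n x _; rewrite mule_ge0// lee_fin.
- by move=> x _ k n kn; rewrite lee_wpmul2r ?lee_fin// -lee_fin nd_h.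
apply: eq_integral => x _; apply/cvg_lim => //.
by apply: cvgeMr => //; exact: hH.
Qed.

End nonnegative_integrals.

Section density_measure.
Context d (T : measurableType d) (R : realType).
Variables (m : {measure set T -> \bar R}) (w : T -> R).
Hypotheses (mw : measurable_fun setT w) (w0 : forall x, 0 <= w x).
Local Open Scope ereal_scope.

(** The two proofs are arguments so that the measure structure can be
    attached to the term itself. *)
Definition density_measure of measurable_fun setT w & (forall x, 0 <= w x)%R :=
  fun A => \int[m]_(x in A) (w x)%:E.

Local Notation nu := (density_measure mw w0).

Let density0 : nu set0 = 0.
Proof. exact: integral_set0. Qed.

Let density_ge0 A : 0 <= nu A.
Proof. by apply: integral_ge0 => x _; rewrite lee_fin. Qed.

Let density_sigma_additive : semi_sigma_additive nu.
Proof.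
move=> F mF tF mUF; rewrite /density_measure ge0_integral_bigcup//.
- by apply: is_cvg_nneseries => n _ _; exact: density_ge0.
- exact/measurable_funTS/measurable_EFinP.
- by move=> x _; rewrite lee_fin.
Qed.

HB.instance Definition _ :=
  isMeasure.Build _ _ _ nu density0 density_ge0 density_sigma_additive.

End density_measure.
Arguments density_measure {d T R} m {w} mw w0 A.

(** * The tangent substitution *)

Section tangent.
Context {R : realType}.
Notation mu := (@lebesgue_measure R).
Local Open Scope ereal_scope.

Let D : set R := `](- (pi / 2))%R, (pi / 2)%R[%classic.
Let w (t : R) : R := (\1_D t * (cos t) ^- 2)%R.

Lemma measurable_inv : measurable_fun setT (@GRing.inv R).
Proof.
rewrite -(setvU [set 0%R]); apply/measurable_funU => //.
  exact: measurableC.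
split; last exact: measurable_fun_set1.
apply: open_continuous_measurable_fun.
  apply: closed_openC; apply: accessible_closed_set1.
  exact: hausdorff_accessible.
by move=> x; rewrite inE /= => /eqP x0; exact: inv_continuous.
Qed.

Lemma measurable_tan : measurable_fun setT (@tan R).
Proof.
apply: measurable_funM.
  by apply: continuous_measurable_fun; exact: continuous_sin.
apply: (measurableT_comp measurable_inv).
by apply: continuous_measurable_fun; exact: continuous_cos.
Qed.

Let mw : measurable_fun setT w.
Proof.
apply: measurable_funM; first by apply: measurable_indic; exact: measurable_itv.
apply: (measurableT_comp measurable_inv); apply: measurable_funX.
by apply: continuous_measurable_fun; exact: continuous_cos.
Qed.

Let w0 t : (0 <= w t)%R.
Proof. by rewrite mulr_ge0// invr_ge0 sqr_ge0. Qed.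

Lemma tan_preimage_itv (x y : R) :
  D `&` (@tan R) @^-1` `]x, y]%classic = `]atan x, atan y]%classic.
Proof.
apply/seteqP; split => t /=; rewrite !in_itv/=.
  move=> [tD /andP[xt ty]]; have := tanK tD => <-.
  apply/andP; split; [exact: lt_atan|exact: le_atan].
move=> /andP[xt ty].
have tD : D t.
  rewrite /D/= in_itv/= (lt_trans (atan_gtNpi2 x) xt)/=.
  exact: le_lt_trans ty (atan_ltpi2 y).
split => //; apply/andP; split.
  rewrite -(atanK x) ltr_tan//.
  by rewrite in_itv/= atan_gtNpi2 atan_ltpi2.
rewrite -(atanK y) leNgt ltr_tan// -?leNgt//.
by rewrite in_itv/= atan_gtNpi2 atan_ltpi2.
Qed.

Lemma integral_cosV2 (x y : R) : (x < y)%R ->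
  \int[mu]_(t in `]atan x, atan y]%classic) ((cos t) ^- 2)%:E = (y - x)%:E.
Proof.
move=> xy.
have sub t : t \in `[atan x, atan y] -> cos t != 0%R.
  rewrite in_itv/= => /andP[xt ty]; rewrite gt_eqF// cos_gt0_pihalf//.
  by rewrite (lt_le_trans (atan_gtNpi2 x) xt) (le_lt_trans ty (atan_ltpi2 y)).
rewrite integral_itv_obnd_cbnd.
  rewrite (@continuous_FTC2 _ _ (@tan R)).
  - by rewrite !atanK.
  - exact: lt_atan.
  - apply: continuous_in_subspaceT => t.
    rewrite inE /= => /sub ct.
    apply: cvgV; first by rewrite sqrf_eq0.
    by apply: cvgM; exact: continuous_cos.
  - split.
    + move=> t tab; apply: derivable_tan; apply: sub.
      exact: subset_itv_oo_cc tab.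
    + apply: cvg_at_right_filter; apply: continuous_tan; apply: sub.
      by rewrite in_itv/= lexx ltW// lt_atan.
    + apply: cvg_at_left_filter; apply: continuous_tan; apply: sub.
      by rewrite in_itv/= lexx ltW// lt_atan.
  - move=> t tab.
    rewrite derive1E; apply: derive_val.
    apply: is_derive_tan.
    apply: sub; exact: subset_itv_oo_cc tab.
apply: measurable_funTS; apply/measurable_EFinP.
apply: (measurableT_comp measurable_inv); apply: measurable_funX.
by apply: continuous_measurable_fun; exact: continuous_cos.
Qed.

(** On ]- pi / 2, pi / 2[, the measure of density 1 / cos ^ 2 is carried by
    tan to Lebesgue measure: on ]x, y] this is the fundamental theorem of
    calculus between atan x and atan y. *)
Lemma ge0_integral_tan (H : R -> \bar R) :
  measurable_fun setT H -> (forall x, 0 <= H x) ->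
  \int[mu]_x H x = \int[mu]_(t in D) (H (tan t) * ((cos t) ^- 2)%:E).
Proof.
move=> mH H0.
pose dens : {measure set (measurableTypeR R) -> \bar R} :=
  density_measure mu mw w0.
pose tanm : measurableTypeR R -> measurableTypeR R := @tan R.
have mtan : measurable_fun setT tanm := measurable_tan.
pose nu : {measure set (measurableTypeR R) -> \bar R} :=
  image_measure dens mtan.
transitivity (\int[nu]_x H x).
  apply: eq_measure_integral => //= A mA _.
  apply: lebesgue_measure_unique => // _ [[x y] _ <-].
  rewrite /= /pushforward /dens /density_measure /=.
  under eq_integral => t _.
    rewrite (_ : (w t)%:E = ((fun t => ((cos t) ^- 2)%:E) \_ D) t); last first.
      by rewrite /w patchE indicE; case: ifPn => _; rewrite (mul1r, mul0r).
    over.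
  rewrite -integral_mkcondl /=. 
  rewrite tan_preimage_itv.
  have [xy|yx] := ltP x y; last first.
    rewrite !set_itv_ge ?integral_set0 ?measure0//.
      by rewrite bnd_simp -leNgt le_atan.
    by rewrite bnd_simp -leNgt.
  by rewrite integral_cosV2// lebesgue_measure_itv/= lte_fin xy.
rewrite (ge0_integral_pushforward mtan)//.
rewrite preimage_setT (@ge0_integral_density _ _ _ mu dens w)//=; last first.
  exact: (measurableT_comp mH measurable_tan).
rewrite [RHS]integral_mkcond; apply: eq_integral => t _.
by rewrite patchE /w indicE; case: ifPn => _; rewrite ?mul1r// mul0r mule0.
Qed.

End tangent.

(** * Polar coordinates *)

Section polar.
Context {R : realType}.
Notation mu := (@lebesgue_measure R).
Local Open Scope ereal_scope.
Notation RM := (measurableTypeR R).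
Notation M2 := (measurableTypeR R * measurableTypeR R)%type.

Lemma measurable_fun_affine (a b : R) :
  measurable_fun setT (fun t : R => a * t + b)%R.
Proof. by apply: measurable_funD => //; apply: measurable_funM. Qed.

Lemma integral_itv_if (i : interval R) (f : R -> \bar R) :
  \int[mu]_(x in [set` i]) f x = \int[mu]_x (if x \in i then f x else 0).
Proof.
rewrite integral_mkcond; apply: eq_integral => x _.
by rewrite patchE mem_setE.
Qed.

Lemma integral_itvco_shift (f : R -> \bar R) (a b c : R) :
  measurable_fun setT f -> (forall x, 0 <= f x) ->
  \int[mu]_(t in `[(a + c)%R, (b + c)%R[) f t =
  \int[mu]_(t in `[a, b[) f (t + c)%R.
Proof.
move=> mf f0; rewrite integral_mkcond (@ge0_integral_affine _ 1 c)//.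
- rewrite normr1 mul1e [RHS]integral_mkcond; apply: eq_integral => t _.
  rewrite !patchE mul1r; congr (if _ then _ else _).
  by apply/idP/idP; rewrite !inE/= !in_itv/= lerD2r ltrD2r.
- apply/(measurable_restrictT _ _).1 => //.
  exact: measurable_funTS.
- by move=> x; apply: erestrict_ge0.
Qed.

Lemma integral_itvco_split (f : R -> \bar R) (a b c : R) :
  (a <= b)%R -> (b <= c)%R ->
  measurable_fun setT f -> (forall x, 0 <= f x) ->
  \int[mu]_(t in `[a, c[) f t =
  \int[mu]_(t in `[a, b[) f t + \int[mu]_(t in `[b, c[) f t.
Proof.
move=> ab bc mf f0; rewrite -ge0_integral_setU//=.
- congr integral; apply/seteqP; split => t /=; rewrite !in_itv/=.
    by move=> /andP[at_ tc]; have [tb|bt] := ltP t b; [left|right]; apply/andP.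
  by case=> /andP[h1 h2]; apply/andP; split => //;
    [exact: lt_le_trans bc|exact: le_trans h1].
- exact: measurable_funTS.
- apply/disj_set2P; apply/seteqP; split => t //= -[]; rewrite !in_itv/=.
  by move=> /andP[_ tb] /andP[bt _]; move: (lt_le_trans tb bt); rewrite ltxx.
Qed.

(** Iterated integrals are written with curried integrands, whereas
    Tonelli's theorem concerns functions of a pair. *)
Definition jointly_measurable (k : R -> R -> \bar R) :=
  measurable_fun [set: M2] (fun v : M2 => k v.1 v.2).

Lemma measurable_integral_param d (T : measurableType d)
    (k : T -> R -> \bar R) :
  measurable_fun [set: T * RM] (fun v : T * RM => k v.1 v.2) ->
  (forall x y, 0 <= k x y) ->
  measurable_fun setT (fun x : T => \int[mu]_y k x y).
Proof.
move=> mk k0; exact: (@measurable_fun_fubini_tonelli_F _ _ _ _ R mu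
  (fun v : T * RM => k v.1 v.2) mk (fun v => k0 v.1 v.2)).
Qed.

Lemma measurable_integral_snd (k : R -> R -> \bar R) :
  jointly_measurable k -> (forall x y, 0 <= k x y) ->
  measurable_fun setT (fun x : R => \int[mu]_y k x y).
Proof. exact: measurable_integral_param. Qed.

Lemma measurable_integral_fst (k : R -> R -> \bar R) :
  jointly_measurable k -> (forall x y, 0 <= k x y) ->
  measurable_fun setT (fun y : R => \int[mu]_x k x y).
Proof.
move=> mk k0; exact: (@measurable_fun_fubini_tonelli_G _ _ _ _ R mu
  (fun v : M2 => k v.1 v.2) mk (fun v => k0 v.1 v.2)).
Qed.

Lemma tonelli_swap (k : R -> R -> \bar R) :
  jointly_measurable k -> (forall x y, 0 <= k x y) ->
  \int[mu]_x \int[mu]_y k x y = \int[mu]_y \int[mu]_x k x y.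
Proof.
move=> mk k0; exact: (@fubini_tonelli _ _ _ _ R mu mu
  (fun v : M2 => k v.1 v.2) mk (fun v => k0 v.1 v.2)).
Qed.

Lemma jointly_measurable_fst (k : R -> R -> \bar R) y :
  jointly_measurable k -> measurable_fun setT (fun x : R => k x y).
Proof. by move=> mk; exact: (measurableT_comp mk (pair2_measurable y)). Qed.

Lemma jointly_measurable_snd (k : R -> R -> \bar R) x :
  jointly_measurable k -> measurable_fun setT (fun y : R => k x y).
Proof. by move=> mk; exact: (measurableT_comp mk (pair1_measurable x)). Qed.

Section polar_coordinates.
Variable g : M2 -> \bar R.
Hypotheses (mg : measurable_fun setT g) (g0 : forall v, 0 <= g v).

(** The factor max(r, 0) is at once the Jacobian r and the restriction to r
    > 0, so that r ranges over the whole line. *)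
Definition polar_integrand (t r : R) : \bar R :=
  (Num.max r 0)%:E * g (r * cos t, r * sin t)%R.

Lemma measurable_cosR : measurable_fun setT (@cos R).
Proof. by apply: continuous_measurable_fun; exact: continuous_cos. Qed.

Lemma measurable_sinR : measurable_fun setT (@sin R).
Proof. by apply: continuous_measurable_fun; exact: continuous_sin. Qed.

Lemma polar_integrand_ge0 t r : 0 <= polar_integrand t r.
Proof. by rewrite mule_ge0// lee_fin le_max lexx orbT. Qed.

Lemma measurable_polar_integrand : jointly_measurable polar_integrand.
Proof.
apply: emeasurable_funM.
  apply/measurable_EFinP; apply: measurable_maxr => //.
apply: (measurableT_comp mg) => //=.
apply: measurable_fun_pair => /=; apply: measurable_funM => //.
  exact: (measurableT_comp measurable_cosR).
exact: (measurableT_comp measurable_sinR).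
Qed.

(** At fixed x > 0, substituting y = x m gives the Jacobian x. Once the
    integrals are exchanged, m = tan t and x = r cos t contribute the
    factors 1 / cos t ^ 2 and cos t, and the product of the three factors is
    r. *)
Lemma polar_right_half :
  \int[mu]_(x in `]0%R, +oo[) \int[mu]_y g (x, y) =
  \int[mu]_(t in `](- (pi / 2))%R, (pi / 2)%R[) \int[mu]_r polar_integrand t r.
Proof.
have mg' : jointly_measurable (fun x y => g (x, y)).
  by apply: eq_measurable_fun mg => -[].
pose k (x m : R) := (Num.max x 0)%:E * g (x, (x * m)%R).
have k0 x m : 0 <= k x m by rewrite mule_ge0// lee_fin le_max lexx orbT.
have mk : jointly_measurable k.
  apply: emeasurable_funM.
    by apply/measurable_EFinP; apply: measurable_maxr.
  apply: (measurableT_comp mg) => //=.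
  by apply: measurable_fun_pair => //=; apply: measurable_funM.
transitivity (\int[mu]_x \int[mu]_m k x m).
  rewrite integral_itv_if; apply: eq_integral => x _.
  case: ifPn; rewrite in_itv/= andbT => x0; last first.
    rewrite integral0_eq// => m _; rewrite /k.
    by rewrite max_r ?mul0e// leNgt.
  rewrite (@ge0_integral_affine _ x 0)//; last 2 first.
  - by rewrite gt_eqF.
  - exact: (@jointly_measurable_snd (fun x y => g (x, y)) x mg').
  rewrite gtr0_norm// -ge0_integralZl_EFin//; last 2 first.
  - exact: (measurableT_comp
      (@jointly_measurable_snd (fun x y => g (x, y)) x mg')
      (measurable_fun_affine _ _)).
  - exact: ltW.
  by apply: eq_integral => m _; rewrite /k addr0 max_l// ltW.
rewrite (tonelli_swap mk k0).
rewrite ge0_integral_tan; last 2 first.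
- exact: measurable_integral_fst.
- by move=> m; apply: integral_ge0.
apply: eq_integral => t; rewrite inE/= in_itv/= => tD.
have c0 : (0 < cos t)%R by exact: cos_gt0_pihalf.
rewrite (@ge0_integral_affine _ (cos t) 0)//; last 2 first.
- by rewrite gt_eqF.
- exact: jointly_measurable_fst.
rewrite gtr0_norm// muleAC -EFinM -ge0_integralZl_EFin//; last 2 first.
- exact: (measurableT_comp (jointly_measurable_fst _ mk)
    (measurable_fun_affine _ _)).
- by rewrite mulr_ge0 ?invr_ge0 ?sqr_ge0// ltW.
apply: eq_integral => r _; rewrite /k /polar_integrand addr0 muleA.
congr (_ * g (_, _)).
- rewrite -EFinM; congr EFin.
  rewrite -[X in Num.max _ X](mulr0 (cos t)) -maxr_pMr ?(ltW c0)//.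
  by rewrite expr2 invfM; field; rewrite gt_eqF.
- by rewrite mulrC.
- by rewrite /tan; field; rewrite gt_eqF.
Qed.

Lemma measurable_polar_integral :
  measurable_fun setT (fun t => \int[mu]_r polar_integrand t r).
Proof.
exact: measurable_integral_snd measurable_polar_integrand polar_integrand_ge0.
Qed.

End polar_coordinates.

Lemma polar_integrand_oppr (g : M2 -> \bar R) (t r : R) :
  polar_integrand (fun v : M2 => g (- v.1, - v.2)%R) t r =
  polar_integrand g (t + pi)%R r.
Proof. by rewrite /polar_integrand/= cosDpi sinDpi !mulrN. Qed.

Lemma polar_integrandD2pi (g : M2 -> \bar R) (t r : R) :
  polar_integrand g (t + 2 * pi)%R r = polar_integrand g t r.
Proof. by rewrite /polar_integrand/= mulr_natl cosD2pi sinD2pi. Qed.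

Lemma integral_half_lines (f : R -> \bar R) :
  measurable_fun setT f -> (forall x, 0 <= f x) ->
  \int[mu]_x f x =
  \int[mu]_(x in `]0%R, +oo[) f x + \int[mu]_(x in `]0%R, +oo[) f (- x)%R.
Proof.
move=> mf f0.
have mfD (A : set R) : measurable_fun A f by exact: measurable_funTS.
transitivity (\int[mu]_(x in `[0%R, +oo[ `|` `]-oo, 0%R[) f x).
  congr integral; apply/esym/seteqP; split => // x _.
  rewrite /= !in_itv/= andbT.
  by have [|] := leP 0%R x; [left|right].
rewrite ge0_integral_setU//=.
  rewrite -integral_itv_obnd_cbnd//; congr (_ + _).
  rewrite !integral_itv_if (@ge0_integral_affine _ (-1) 0)//.
  - rewrite normrN1 mul1e; apply: eq_integral => x _.
    by rewrite addr0 mulN1r !in_itv/= oppr_lt0 andbT.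
  - have := (measurable_restrictT f (measurable_itv `]-oo, 0%R[)).1 (mfD _).
    by apply: eq_measurable_fun => x _; rewrite patchE mem_setE.
  - by move=> x; case: ifP.
- exact: mfD.
- apply/disj_set2P; apply/seteqP; split => t //= -[]; rewrite !in_itv/= andbT.
  by move=> t0 /(le_lt_trans t0); rewrite ltxx.
Qed.

(** The left half-plane is the image of the right one by v |-> - v, which is
    the rotation t |-> t + pi. The two ranges of angles, of length pi each,
    are reassembled into [0, 2 pi[ by periodicity. *)
Lemma ge0_integral_polar (g : M2 -> \bar R) :
  measurable_fun setT g -> (forall v, 0 <= g v) ->
  \int[@lebesgue2 R]_v g v =
  \int[mu]_(t in `[0%R, (2 * pi)%R[) \int[mu]_r polar_integrand g t r.
Proof.
move=> mg g0.
pose K t := \int[mu]_r polar_integrand g t r.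
have mK : measurable_fun setT K by exact: measurable_polar_integral.
have K0 t : 0 <= K t by apply: integral_ge0 => r _; exact: polar_integrand_ge0.
have mg' : jointly_measurable (fun x y => g (x, y)).
  by apply: eq_measurable_fun mg => -[].
pose g' : M2 -> \bar R := fun v => g (- v.1, - v.2)%R.
have mg'' : measurable_fun setT g'.
  by apply: (measurableT_comp mg) => /=; apply: measurable_fun_pair => //=;
    exact: measurableT_comp.
transitivity (\int[mu]_x \int[mu]_y g (x, y)).
  exact: (@fubini_tonelli1 _ _ _ _ R mu mu g mg g0).
rewrite integral_half_lines; last 2 first.
- exact: measurable_integral_snd.
- by move=> x; exact: integral_ge0.
rewrite polar_right_half//.
have -> : \int[mu]_(x in `]0%R, +oo[) \int[mu]_y g ((- x)%R, y) =
    \int[mu]_(x in `]0%R, +oo[) \int[mu]_y g' (x, y).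
  have mgx (a : R) : measurable_fun setT (fun y : R => g (a, y)).
    exact: (jointly_measurable_snd a mg').
  apply: eq_integral => x _; rewrite (@ge0_integral_affine _ (-1) 0)//.
  rewrite normrN1 mul1e; apply: eq_integral => y _.
  by rewrite /g' /= addr0 mulN1r.
rewrite (polar_right_half mg''); last by move=> v; exact: g0.
have -> : \int[mu]_(t in `](- (pi / 2))%R, (pi / 2)%R[)
      \int[mu]_r polar_integrand g' t r =
    \int[mu]_(t in `](- (pi / 2))%R, (pi / 2)%R[) K (t + pi)%R.
  apply: eq_integral => t _; apply: eq_integral => r _.
  exact: polar_integrand_oppr.
rewrite -/K.
have pi0 : (0 < pi :> R)%R := pi_gt0 R.
have mKD (A : set R) : measurable_fun A K by exact: measurable_funTS.
have mKpi : measurable_fun setT (fun t : R => K (t + pi)%R).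
  by apply: (measurableT_comp mK); exact: measurable_funD.
have mKpiD (A : set R) : measurable_fun A (fun t : R => K (t + pi)%R).
  exact: measurable_funTS.
rewrite -!(integral_itv_bndoo true true)//.
rewrite -integral_itvco_shift//.
rewrite -/K.
pose J a b := \int[mu]_(t in `[a, b[) K t.
have JD a b c : (a <= b)%R -> (b <= c)%R -> J a c = J a b + J b c.
  by move=> ab bc; exact: integral_itvco_split.
rewrite -/(J _ _) -/(J _ _) -/(J _ _).
rewrite (JD 0%R (pi / 2)%R)//; [|lra..].
rewrite (JD (pi / 2)%R (- (pi / 2) + 2 * pi)%R); [|lra..].
(* The last quarter of the turn is the first half of the right range of
   angles, one period later. *)
have -> : J (- (pi / 2) + 2 * pi)%R (2 * pi)%R = J (- (pi / 2))%R 0%R.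
  rewrite -{2}(add0r (2 * pi)%R) /J (integral_itvco_shift _ _ _ mK K0).
  apply: eq_integral => t _.
  by rewrite /K; under eq_integral do rewrite polar_integrandD2pi.
rewrite (JD (- (pi / 2))%R 0%R); [|lra..].
have -> : (- (pi / 2) + pi = pi / 2 :> R)%R by field.
have -> : (- (pi / 2) + 2 * pi = pi / 2 + pi :> R)%R by field.
by rewrite [RHS]addeA [RHS]addeC addeA.
Qed.

End polar.

(** * Lebesgue measure on the plane *)

Section plane_measure.
Variable R : realType.

(** Sigma-finiteness makes Tonelli's theorem available for pairs of points
    of the plane. *)
HB.instance Definition _ :=
  Measure.copy (@lebesgue2 R) (@lebesgue_measure R \x @lebesgue_measure R)%E.

Let lebesgue2_sigma_finite : sigma_finite setT (@lebesgue2 R).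
Proof.
have /sigma_finiteP[F [TF ndF Foo]] := sigma_finiteT (@lebesgue_measure R).
exists (fun n => F n `*` F n).
  rewrite -setXTT TF; apply/seteqP; split => [[x y]|v [n _ [? ?]]];
    last by split; exists n.
  move=> [/= [n _ Fnx] [k _ Fky]]; exists (maxn n k) => //; split => /=.
  - by move: x Fnx; exact/subsetPset/ndF/leq_maxl.
  - by move: y Fky; exact/subsetPset/ndF/leq_maxr.
move=> k; have [mFk Fkoo] := Foo k; split; first exact: measurableX.
rewrite [ltLHS](product_measure1E (@lebesgue_measure R)
  (@lebesgue_measure R))//.
by rewrite lte_mul_pinfty// ge0_fin_numE.
Qed.

HB.instance Definition _ := Measure_isSigmaFinite.Build _ _ _ (@lebesgue2 R)
  lebesgue2_sigma_finite.

End plane_measure.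

Section plane.
Context {R : realType}.
Notation mu := (@lebesgue_measure R).
Local Open Scope ereal_scope.
Notation M2 := (measurableTypeR R * measurableTypeR R)%type.

(** An open set is the union of the boxes with rational corners that it
    contains, and there are countably many such boxes. *)
Lemma open_measurable2 (U : set (R * R)) : open U -> measurable (U : set M2).
Proof.
move=> oU.
pose box (p : (rat * rat) * (rat * rat)) : set M2 :=
  `]ratr p.1.1, ratr p.1.2[%classic `*` `]ratr p.2.1, ratr p.2.2[%classic.
pose F p := if pselect (box p `<=` U) then box p else set0.
have -> : (U : set M2) = \bigcup_p F p.
  apply/seteqP; split => [[x y] Uxy|v [p _]]; last first.
    by rewrite /F; case: pselect => //= + pv; apply.
  have : nbhs (x, y) U by exact: open_nbhs_nbhs.
  case=> -[/= A B] [/nbhs_ballP[d /= d0 dA] /nbhs_ballP[e /= e0 eB]] ABU.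
  have ratball (z r : R) : (0 < r)%R -> exists p : rat * rat,
      `]ratr p.1, ratr p.2[%classic z /\ `]ratr p.1, ratr p.2[ `<=` ball z r.
    move=> r0.
    have [p1 p1z] : exists q, ratr q \in `](z - r)%R, z[.
      by apply: rat_in_itvoo; lra.
    have [p2 p2z] : exists q, ratr q \in `]z, (z + r)%R[.
      by apply: rat_in_itvoo; lra.
    move: p1z p2z; rewrite !in_itv/= => /andP[? ?] /andP[? ?].
    exists (p1, p2); split => [|t] /=; rewrite in_itv/=; first exact/andP.
    by move=> /andP[? ?]; rewrite ball_itv/= in_itv/=; apply/andP; split; lra.
  have [p [px pd]] := ratball x d d0; have [q [qy qe]] := ratball y e e0.
  exists (p, q) => //; rewrite /F; case: pselect => /= [?|]; first by split.
  by case => -[x' y'] [/= /pd/dA Ax /qe/eB By]; exact: ABU.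
apply: countable_bigcupT_measurable => [|p]; first exact: countableP.
rewrite /F.
case: pselect => /= ? //; apply: measurableX; exact: measurable_itv.
Qed.

(** If s is nonzero, the rotation is performed by two affine substitutions
    in one variable: the first coordinate is replaced by q at a fixed value
    y of the second one, and then y is replaced by t at a fixed value of q.
    Their Jacobians 1 / |s| and |s| cancel. If s = 0, then c = 1 or c = - 1. *)
Lemma ge0_integral_rotation (f : M2 -> \bar R) (c s : R) :
  measurable_fun setT f -> (forall v, 0 <= f v) ->
  (c ^+ 2 + s ^+ 2 = 1)%R ->
  \int[@lebesgue2 R]_v f v =
  \int[mu]_q \int[mu]_t f (q * - s + t * c, q * c + t * s)%R.
Proof.
move=> mf f0 cs1.
have mf' : jointly_measurable (fun x y => f (x, y)).
  by apply: eq_measurable_fun mf => -[].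
have f0' x y : 0 <= f (x, y) by exact: f0.
transitivity (\int[mu]_y \int[mu]_x f (x, y)).
  exact: (@fubini_tonelli2 _ _ _ _ R mu mu f mf f0).
have mfx y : measurable_fun setT (fun x : R => f (x, y)).
  exact: jointly_measurable_fst mf'.
have [s0|s0] := eqVneq s 0%R.
  have c0 : c != 0%R.
    by apply: contra_eq_neq cs1 => ->; rewrite s0 expr0n addr0 eq_sym oner_eq0.
  have nc : (`|c| = 1)%R.
    apply/eqP; rewrite -sqrp_eq1// real_normK ?num_real//.
    by rewrite -cs1 s0 expr0n addr0.
  rewrite (@ge0_integral_affine _ c 0)//; last 2 first.
  - exact: measurable_integral_fst.
  - by move=> y; apply: integral_ge0.
  rewrite nc mul1e; apply: eq_integral => q _.
  rewrite (@ge0_integral_affine _ c 0)//.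
  rewrite nc mul1e; apply: eq_integral => t _.
  by congr (f (_, _)); rewrite s0; ring.
(* Solving y = q c + t s for t in q (- s) + t c gives - q / s + y c / s. *)
pose k (y q : R) := f (- s^-1 * q + y * c / s, y)%R.
have mk : jointly_measurable k.
  apply: (measurableT_comp mf) => /=; apply: measurable_fun_pair => //=.
  by apply: measurable_funD; do ?apply: measurable_funM.
have k0 y q : 0 <= k y q by exact: f0.
transitivity (`|s^-1|%:E * \int[mu]_y \int[mu]_q k y q).
  rewrite -ge0_integralZl_EFin//; last 2 first.
  - by move=> y _; exact: integral_ge0.
  - exact: measurable_integral_snd.
  apply: eq_integral => y _.
  rewrite (@ge0_integral_affine _ (- s^-1) (y * c / s))//.
    by rewrite normrN.
  by rewrite oppr_eq0 invr_eq0.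
rewrite (tonelli_swap mk k0) -ge0_integralZl_EFin//; last 2 first.
- by move=> q _; exact: integral_ge0.
- exact: measurable_integral_fst.
apply: eq_integral => q _.
rewrite (@ge0_integral_affine _ s (q * c))//; last first.
  exact: jointly_measurable_fst mk.
rewrite muleA -EFinM -normrM mulVf// normr1 mul1e.
apply: eq_integral => t _; rewrite /k; congr (f (_, _)); last by ring.
have -> : (- s^-1 * q + (s * t + q * c) * c / s =
           q * (c ^+ 2 - 1) / s + t * c)%R.
  by field.
by have -> : (c ^+ 2 - 1 = - s ^+ 2)%R; [lra|field].
Qed.

Lemma ge0_integral_translation (f : M2 -> \bar R) (a : M2) :
  measurable_fun setT f -> (forall v, 0 <= f v) ->
  \int[@lebesgue2 R]_v f v =
  \int[@lebesgue2 R]_v f (a.1 + v.1, a.2 + v.2)%R.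
Proof.
move=> mf f0.
have mf' : jointly_measurable (fun x y => f (x, y)).
  by apply: eq_measurable_fun mf => -[].
pose fa : M2 -> \bar R := fun v => f (a.1 + v.1, a.2 + v.2)%R.
have mfa : measurable_fun setT fa.
  apply: (measurableT_comp mf) => /=; apply: measurable_fun_pair => /=;
   exact: measurable_funD.
have fa0 v : 0 <= fa v by exact: f0.
transitivity (\int[mu]_x \int[mu]_y f (x, y)).
  exact: (@fubini_tonelli1 _ _ _ _ R mu mu f mf f0).
transitivity (\int[mu]_x \int[mu]_y fa (x, y)); last first.
  exact/esym/(@fubini_tonelli1 _ _ _ _ R mu mu fa mfa fa0).
rewrite (@ge0_integral_affine _ 1 a.1)//; last 2 first.
- exact: measurable_integral_snd.
- by move=> x; exact: integral_ge0.
rewrite normr1 mul1e; apply: eq_integral => x _.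
have mfx (b : R) : measurable_fun setT (fun y : R => f (b, y)).
  exact: jointly_measurable_snd mf'.
rewrite (@ge0_integral_affine _ 1 a.2)//.
rewrite normr1 mul1e; apply: eq_integral => y _.
by rewrite /fa; congr (f (_, _)) => /=; ring.
Qed.

End plane.

(** * Points leaving a subset of the line *)

Section exit.
Context {R : realType}.
Notation mu := (@lebesgue_measure R).
Local Open Scope ereal_scope.

Lemma powRN_cvgy0 (s : R) : (0 < s)%R -> (r `^ (- s))%R @[r --> +oo%R] --> 0%R.
Proof.
move=> s0; apply/cvgrPdist_le => e e0; near=> r.
rewrite sub0r normrN ger0_norm ?powR_ge0// powRN.
have r0 : (0 < r)%R by near: r; exact: nbhs_pinfty_gt.
rewrite -[leRHS]invrK lef_pV2 ?posrE ?invr_gt0 ?powR_gt0//.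
have -> : (e^-1 = (e^-1 `^ s^-1) `^ s)%R.
  by rewrite -powRrM mulVf ?gt_eqF// powRr1// invr_ge0 ltW.
apply: ge0_ler_powR; rewrite ?nnegrE ?(ltW s0) ?powR_ge0 ?(ltW r0)//.
Unshelve. all: by end_near. Qed.

Lemma integral_powR_tail (s c : R) : (0 < s)%R -> (0 < c)%R ->
  \int[mu]_(r in `[c, +oo[) (r `^ (- (1 + s)))%:E = (c `^ (- s) / s)%:E.
Proof.
move=> s0 c0.
pose F (r : R) : R := (- s^-1 * r `^ (- s))%R.
have dF (r : R) : (0 < r)%R -> is_derive r 1%R F (r `^ (- (1 + s)))%R.
  move=> r0; have dP := is_derive1_powR (- s) r0.
  have dZ := is_deriveZ (- s^-1)%R dP.
  apply: (is_derive_eq dZ).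
  rewrite /GRing.scale/= mulrA mulrNN mulVf ?gt_eqF// mul1r.
  by congr (_ `^ _)%R; ring.
have cF (r : R) : (0 < r)%R -> {for r, continuous F}.
  move=> r0; have dFr := dF r r0.
  by apply/differentiable_continuous/derivable1_diffP; exact: ex_derive.
rewrite (@ge0_continuous_FTC2y _ _ F _ 0%R).
- by rewrite -EFinB /F; congr EFin; field; rewrite gt_eqF.
- by move=> r _; exact: powR_ge0.
- apply: derivable_within_continuous => r; rewrite in_itv/= andbT => cr.
  by apply: derivable_powR; rewrite in_itv/= andbT (lt_le_trans c0).
- rewrite -(mulr0 (- s^-1)%R); apply: cvgMr.
  exact: powRN_cvgy0.
- by move=> r cr; have dFr := dF r (lt_trans c0 cr); exact: ex_derive.
- by apply: cvg_at_right_filter; exact: cF.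
- move=> r; rewrite in_itv/= andbT => cr; rewrite derive1E.
  by have dFr := dF r (lt_trans c0 cr); exact: derive_val.
Qed.
(** The integrand may be unbounded near 0, so the fundamental theorem of
    calculus is applied on [L / (n + 2), L[, and n tends to infinity. *)
Lemma integral_powR_head (s L : R) : (s < 1)%R -> (0 < L)%R ->
  \int[mu]_(r in `]0%R, L[) (r `^ (- s))%:E = (L `^ (1 - s) / (1 - s))%:E.
Proof.
move=> s1 L0.
have s1' : (0 < 1 - s)%R by rewrite subr_gt0.
have s1n : (1 - s != 0)%R by rewrite gt_eqF.
pose F (r : R) : R := ((1 - s)^-1 * r `^ (1 - s))%R.
have dF (r : R) : (0 < r)%R -> is_derive r 1%R F (r `^ (- s))%R.
  move=> r0; have dP := is_derive1_powR (1 - s) r0.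
  have dZ := is_deriveZ (1 - s)^-1%R dP.
  apply: (is_derive_eq dZ).
  rewrite /GRing.scale/= mulrA mulVf// mul1r.
  by congr (_ `^ _)%R; ring.
have cF (r : R) : (0 < r)%R -> {for r, continuous F}.
  move=> r0; have dFr := dF r r0.
  by apply/differentiable_continuous/derivable1_diffP; exact: ex_derive.
pose e n : R := (L / n.+2%:R)%R.
have e0 n : (0 < e n)%R by rewrite divr_gt0.
have eL n : (e n < L)%R by rewrite ltr_pdivrMr// ltr_pMr// ltr1n.
have eto0 : e n @[n --> \oo] --> 0%R.
  rewrite -(mulr0 L); apply: cvgMr.
  rewrite (_ : (fun n => _) = fun n => harmonic (n + 1)%N).
    by rewrite (cvg_shiftn 1 (@harmonic R)); exact: cvg_harmonic.
  by apply/funext => n; rewrite /harmonic addn1.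
have mp (D : set R) : measurable_fun D (fun r => (r `^ (- s))%:E).
  by apply: measurable_funTS; apply/measurable_EFinP; exact: measurable_powR.
have IE n : \int[mu]_(r in `[e n, L[) (r `^ (- s))%:E = (F L - F (e n))%:E.
  rewrite integral_itv_bndo_bndc//.
  rewrite (@continuous_FTC2 _ _ F)//.
  - apply: derivable_within_continuous => r; rewrite in_itv/= => /andP[er _].
    by apply: derivable_powR; rewrite in_itv/= andbT (lt_le_trans (e0 n)).
  - split.
    + move=> r; rewrite in_itv/= => /andP[er _].
      by have dFr := dF r (lt_trans (e0 n) er); exact: ex_derive.
    + by apply: cvg_at_right_filter; exact: cF.
    + by apply: cvg_at_left_filter; exact: cF.
  - move=> r; rewrite in_itv/= => /andP[er _]; rewrite derive1E.
    by have dFr := dF r (lt_trans (e0 n) er); exact: derive_val.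
have -> : `]0%R, L[%classic = \bigcup_n `[e n, L[%classic.
  apply/seteqP; split => r /=; last first.
    move=> [n _] /=; rewrite !in_itv/= => /andP[er ->].
    by rewrite (lt_le_trans (e0 n)).
  rewrite in_itv/= => /andP[r0 rL].
  have [n _ /(_ _ (leqnn _)) /ltW en] : \forall n \near \oo, (e n < r)%R.
    exact: (cvgr_lt _ eto0).
  by exists n => //=; rewrite in_itv/= en.
have cI : (F L - F (e n))%:E @[n --> \oo] -->
    \int[mu]_(r in \bigcup_n `[e n, L[%classic) (r `^ (- s))%:E.
  under eq_cvg do rewrite -IE.
  apply: (@ge0_nondecreasing_set_cvg_integral _ (measurableTypeR R)).
  - move=> n m nm; apply/subsetPset => r /=; rewrite !in_itv/= => /andP[er ->].
    rewrite andbT (le_trans _ er)// ler_pM2l// lef_pV2 ?posrE//.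
    by rewrite ler_nat !ltnS.
  - by move=> n; exact: measurable_itv.
  - by move=> n; exact: mp.
  - by move=> n r _; rewrite lee_fin powR_ge0.
have cL : (F L - F (e n))%:E @[n --> \oo] --> (L `^ (1 - s) / (1 - s))%:E.
  apply: cvg_EFin; first by near=> n.
  rewrite (_ : (L `^ (1 - s) / (1 - s) = F L - (1 - s)^-1 * 0)%R); last first.
    by rewrite /F mulr0 subr0 mulrC.
  apply: cvgB; first exact: cvg_cst.
  apply: cvgMr.
  by have /cvg_at_rightP := powR_cvg0 s1'; apply.
by rewrite -(cvg_lim _ cI)// (cvg_lim _ cL).
Unshelve. all: by end_near. Qed.

(** The kernel |h| ^ (- 2 - s) of the fractional perimeter, at distance r,
    multiplied by the polar Jacobian r. *)
Definition radial_kernel (s r : R) : R :=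
  (\1_(`]0%R, +oo[%classic : set R) r * r `^ (- (1 + s)))%R.

Lemma radial_kernel_ge0 s r : (0 <= radial_kernel s r)%R.
Proof. by rewrite mulr_ge0// powR_ge0. Qed.

Lemma measurable_radial_kernel s : measurable_fun setT (radial_kernel s).
Proof.
apply: measurable_funM; last exact: measurable_powR.
by apply: measurable_indic; exact: measurable_itv.
Qed.

(** The interaction of the point t of the line with the part of the
    complement of A that lies ahead of it. *)
Definition exit_integral (s : R) (A : set R) (t : R) : \bar R :=
  \int[mu]_r (\1_(~` A) (t + r)%R * radial_kernel s r)%:E.

Lemma exit_integral_ge0 s A t : 0 <= exit_integral s A t.
Proof.
by apply: integral_ge0 => r _; rewrite lee_fin mulr_ge0// radial_kernel_ge0.
Qed.

(** Ahead of a point of ]a, b[, the complement of ]a, b[ begins at b. *)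
Lemma exit_integral_itv (s a b t : R) : (0 < s)%R -> (a < t < b)%R ->
  exit_integral s `]a, b[%classic t = ((b - t) `^ (- s) / s)%:E.
Proof.
move=> s0 /andP[at_ tb]; rewrite -integral_powR_tail ?subr_gt0//.
rewrite integral_itv_if; apply: eq_integral => r _.
rewrite /radial_kernel !indicE !mem_setE in_setC mem_setE !in_itv/= !andbT.
have [r0|r0] := ltP 0%R r; last first.
  rewrite mul0r mulr0 leNgt (le_lt_trans r0) ?subr_gt0//.
by rewrite lerBlDl (lt_trans at_) ?ltrDl//= -leNgt; case: ifP;
  rewrite ?mul1r// mul0r.
Qed.

Lemma le_exit_integral (s : R) (A B : set R) (t : R) : A `<=` B ->
  exit_integral s B t <= exit_integral s A t.
Proof.
move=> AB; apply: le_integral_ge0 => r _.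
  by rewrite lee_fin mulr_ge0// radial_kernel_ge0.
rewrite lee_fin ler_wpM2r ?radial_kernel_ge0// !indicE !in_setC ler_nat.
have [/set_mem/AB/mem_set -> //|_] := boolP ((t + r)%R \in A).
exact: leq_b1.
Qed.

(** The constant 1 / (s (1 - s)) of the theorem arises here: 1 / s comes
    from the integral over the distance r, and 1 / (1 - s) from the integral
    over the position t. *)
Lemma integral_exit_itv (s a b : R) :
  (0 < s)%R -> (s < 1)%R -> (a < b)%R ->
  \int[mu]_(t in `]a, b[) exit_integral s `]a, b[%classic t =
  ((b - a) `^ (1 - s) / (s * (1 - s)))%:E.
Proof.
move=> s0 s1 ab.
transitivity (\int[mu]_(t in `]a, b[) ((b - t) `^ (- s) / s)%:E).
  apply: eq_integral => t; rewrite mem_setE in_itv/= => atb.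
  exact: exit_integral_itv.
pose f (t : R) : \bar R :=
  if t \in `]a, b[ then ((b - t) `^ (- s) / s)%:E else 0.
have f0 t : 0 <= f t.
  by rewrite /f; case: ifP => // _; rewrite lee_fin divr_ge0 ?powR_ge0// ltW.
have mpow : measurable_fun setT (fun x : R => (x `^ (- s))%:E).
  by apply/measurable_EFinP; exact: measurable_powR.
have mf : measurable_fun setT f.
  apply: measurable_fun_ifT => //.
    apply: (@measurable_fun_bool _ _ _ _ true).
    rewrite setTI (_ : _ @^-1` _ = `]a, b[%classic)//.
  apply/measurable_EFinP; apply: measurable_funM => //.
  apply: (measurableT_comp (@measurable_powR _ _)).
  exact: measurable_funB.
rewrite integral_itv_if -/f (@ge0_integral_affine _ (-1) b)//.
rewrite normrN1 mul1e.
transitivity (\int[mu]_(x in `]0%R, (b - a)%R[) ((s^-1)%:E * (x `^ (- s))%:E)).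
  rewrite integral_itv_if; apply: eq_integral => x _; rewrite /f mulN1r.
  have -> : ((- x + b)%R \in `]a, b[) = (x \in `]0%R, (b - a)%R[).
    by rewrite !in_itv/=; apply/andP/andP => -[? ?]; split; lra.
  by case: ifP => // _; rewrite -EFinM mulrC; congr (_ * _ `^ _)%:E; ring.
rewrite ge0_integralZl_EFin//.
- rewrite integral_powR_head ?subr_gt0// -EFinM; congr EFin.
  by field; rewrite !gt_eqF ?subr_gt0.
- by move=> x _; rewrite lee_fin powR_ge0.
- exact: measurable_funTS.
- by rewrite invr_ge0 ltW.
Qed.

Lemma open_bounded_interval (I : set R) : open I -> is_interval I ->
  has_lbound I -> has_ubound I -> I !=set0 ->
  exists a b : R, (a < b)%R /\ I = `]a, b[%classic.
Proof.
move=> oI iI lI uI [x Ix]; exists (inf I), (sup I).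
have IE : I = `]inf I, sup I[%classic.
  move: (interval_bounded_interior iI lI uI).
  by rewrite (interior_id I).1// => {1}->.
split => //; move: Ix; rewrite {1}IE /= in_itv/= => /andP[]; exact: lt_trans.
Qed.

Lemma separated_open (T : topologicalType) (A B : set T) :
  open A -> open B -> A `&` B = set0 -> separated A B.
Proof.
move=> oA oB AB0; split; apply/seteqP; split => // x [].
  move=> cA Bx; have := cA B (open_nbhs_nbhs (conj oB Bx)).
  by rewrite AB0 => -[].
move=> Ax cB; have := cB A (open_nbhs_nbhs (conj oA Ax)).
by rewrite setIC AB0 => -[].
Qed.

(** The union of the I j with j != i is open and disjoint from I i, so a
    connected subset of the whole union that meets I i cannot leave it. *)
Lemma connected_component_bigcup_open (T : topologicalType) (I : nat -> set T)
    (i : nat) (x : T) :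
  (forall j, open (I j)) -> connected (I i) -> trivIset setT I -> I i x ->
  connected_component (\bigcup_j I j) x = I i.
Proof.
move=> oI cI tI Iix; apply/seteqP; split; last first.
  by apply: connected_component_max => //; exact: bigcup_sup.
pose B := \bigcup_(j in [set j | j != i]) I j.
have oB : open B by exact: bigcup_open.
have sep : separated (I i) B.
  apply: separated_open => //; apply/seteqP; split => // y [Iy [j /= ji Ijy]].
  move/trivIsetP : tI => /(_ i j Logic.I Logic.I); rewrite eq_sym => /(_ ji).
  by move=> /seteqP[+ _] => /(_ y); apply.
have cover : connected_component (\bigcup_j I j) x `<=` I i `|` B.
  apply: subset_trans (@connected_component_sub _ _ _) _ => y [j _ Ijy].
  by have [<-|ji] := eqVneq j i; [left|right; exists j].
have xC : connected_component (\bigcup_j I j) x x.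
  by apply: connected_component_refl; exists i.
have [//|CB] := connected_subset sep cover (@component_connected _ _ _).
move: (CB _ xC) => Bx; exfalso; case: sep => /seteqP[+ _] _; apply.
by split; [exact: subset_closure Iix|exact: Bx].
Qed.

Lemma esum_subset (T : choiceType) (P Q : set T) (a : T -> \bar R) :
  P `<=` Q -> (forall x, 0 <= a x) -> \esum_(i in P) a i <= \esum_(i in Q) a i.
Proof.
move=> PQ a0; rewrite esum_mkcond [leRHS]esum_mkcond; apply: le_esum => x _.
have [/set_mem/PQ/mem_set -> //|_] := boolP (x \in P).
by case: ifP.
Qed.

Lemma measurable_exit_integral (s : R) (A : set R) :
  measurable (A : set (measurableTypeR R)) ->
  measurable_fun setT (exit_integral s A).
Proof.
move=> mA.
apply: (@measurable_integral_snd _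
  (fun t r => (\1_(~` A) (t + r)%R * radial_kernel s r)%:E)).
  apply/measurable_EFinP; apply: measurable_funM.
    apply: (@measurableT_comp _ _ _ _ _ _ (\1_(~` A) : R -> R)).
      by apply: measurable_indic; exact: measurableC.
    exact: measurable_funD.
  exact: (measurableT_comp (measurable_radial_kernel s)).
by move=> t r; rewrite lee_fin mulr_ge0// radial_kernel_ge0.
Qed.

Lemma lebesgue_measure_poweR_itv (a b p : R) : (a < b)%R ->
  poweR (mu `]a, b[%classic) p = ((b - a) `^ p)%:E.
Proof.
by move=> ab; rewrite lebesgue_measure_itv/= lte_fin ab -EFinB poweR_EFin.
Qed.

Section chord_sum.
Variables (s : R) (A : set R).
Hypotheses (s0 : (0 < s)%R) (s1 : (s < 1)%R).
Hypotheses (oA : open A) (lA : has_lbound A) (uA : has_ubound A).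

Let K := (s * (1 - s))%R.
Let K0 : (0 < K)%R. Proof. by rewrite mulr_gt0// subr_gt0. Qed.

Let has_lbound_sub (B : set R) : B `<=` A -> has_lbound B.
Proof. by move=> BA; case: lA => x xA; exists x => y /BA/xA. Qed.

Let has_ubound_sub (B : set R) : B `<=` A -> has_ubound B.
Proof. by move=> BA; case: uA => x xA; exists x => y /BA/xA. Qed.

(** A half-line that leaves an interval does not come back, so the
    complement of A coincides, ahead of its points, with the complement of
    its only component. *)
Lemma exit_integral_interval : is_interval A ->
  K%:E * \int[mu]_(t in A) exit_integral s A t =
  \esum_(J in interval_components A) poweR (mu J) (1 - s).
Proof.
move=> iA; have [->|/set0P A0] := eqVneq A set0.
  by rewrite integral_set0 mule0 /interval_components image_set0 esum_set0.
have -> : interval_components A = [set A].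
  apply/seteqP; split => [_ [x Ax <-]|_ ->] /=.
    by rewrite connected_component_id//; exact/connected_intervalP.
  case: A0 => x Ax; exists x => //.
  by rewrite connected_component_id//; exact/connected_intervalP.
rewrite esum_set1 ?poweR_ge0//.
have [a [b [ab ->]]] := open_bounded_interval oA iA lA uA A0.
rewrite integral_exit_itv// lebesgue_measure_poweR_itv// -EFinM.
by rewrite mulrCA divff ?mulr1// gt_eqF.
Qed.

(** For t in a component J of A, the exit integral can only increase when
    the complement of A is replaced by the larger complement of J. The
    components are disjoint and countably many, so the integral over A is
    the sum of the integrals over the components. *)
Lemma exit_integral_le_chord_sum :
  K%:E * \int[mu]_(t in A) exit_integral s A t <=
  \esum_(J in interval_components A) poweR (mu J) (1 - s).
Proof.
pose I := open_disjoint_itv oA.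
have oI i : open (I i) by exact: open_disjoint_itv_open.
have iI i : is_interval (I i) by exact: open_disjoint_itv_is_interval.
have tI : trivIset setT I by exact: open_disjoint_itv_trivIset.
have AI : A = \bigcup_i I i by exact: open_disjoint_itv_bigcup.
have IA i : I i `<=` A by rewrite AI; exact: bigcup_sup.
have mE : measurable_fun setT (exit_integral s A).
  by apply: measurable_exit_integral; exact: open_measurable.
rewrite {1}AI (@ge0_integral_bigcup _ (measurableTypeR R))//; last 3 first.
- by move=> i; exact: open_measurable.
- exact: measurable_funTS.
- by move=> t _; exact: exit_integral_ge0.
rewrite -nneseriesZl; last first.
  by move=> i _; apply: integral_ge0 => t _; exact: exit_integral_ge0.
apply: (@le_trans _ _ (\sum_(i <oo) poweR (mu (I i)) (1 - s))).
  apply: lee_nneseries => i _.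
    move=> _; rewrite mule_ge0 ?lee_fin ?(ltW K0)//.
    by apply: integral_ge0 => t _; exact: exit_integral_ge0.
  have [->|/set0P I0] := eqVneq (I i) set0.
    by rewrite integral_set0 mule0 poweR_ge0.
  have [a [b [ab IE]]] := open_bounded_interval (oI i) (iI i)
    (has_lbound_sub (IA i)) (has_ubound_sub (IA i)) I0.
  apply: (@le_trans _ _ (K%:E * \int[mu]_(t in I i) exit_integral s (I i) t)).
    apply: lee_wpmul2l; first by rewrite lee_fin ltW.
    apply: le_integral_ge0 => t _; first exact: exit_integral_ge0.
    exact: le_exit_integral.
  rewrite IE integral_exit_itv// lebesgue_measure_poweR_itv// -EFinM.
  by rewrite lee_fin mulrCA divff ?mulr1// gt_eqF.
rewrite nneseries_esumT; last by move=> i; exact: poweR_ge0.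
(* The enumeration I may have empty terms: they contribute 0, and the
   nonempty ones are distinct components. *)
pose P := [set i | I i !=set0].
rewrite (_ : \esum_(i in [set: nat]) _ =
    \esum_(i in P) poweR (mu (I i)) (1 - s)); last first.
  rewrite [RHS]esum_mkcond; apply: eq_esum => i _.
  case: ifPn => //; rewrite notin_setE => /set0P/negP/negPn/eqP ->.
  by rewrite measure0 poweR0r// subr_eq0 gt_eqF.
rewrite -(@esum_image _ _ _ P I (fun J => poweR (mu J) (1 - s))).
  apply: esum_subset => [_ [i [x Ix] <-]|J]; last exact: poweR_ge0.
  exists x; first exact: (IA i).
  rewrite [in LHS]AI (@connected_component_bigcup_open _ _ i)//.
  exact/connected_intervalP.
move=> i j /set_mem[x Iix] _ Iij; apply: contrapT => /eqP ij.
move/trivIsetP : tI => /(_ i j Logic.I Logic.I ij) /seteqP[+ _].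
move=> /(_ x); apply.
by split => //; rewrite -Iij.
Qed.

End chord_sum.

End exit.

(** * The perimeter as an integral over lines *)

Section lines.
Context {R : realType}.
Notation mu := (@lebesgue_measure R).
Local Open Scope ereal_scope.
Notation RM := (measurableTypeR R).
Notation M2 := (measurableTypeR R * measurableTypeR R)%type.

Section fixed_set.
Variables (s : R) (Omega : set (R * R)).
Hypothesis oO : open Omega.

(** The integrand of the perimeter in the coordinates of the line of
    direction u through z: t is the position of the point inside Omega, and
    t + r that of the point outside Omega. *)
Definition chord_kernel (u z : M2) (t r : R) : \bar R :=
  (\1_Omega ((z : R * R) + t *: (u : R * R))%R *
   (\1_(~` Omega) ((z : R * R) + (t + r) *: (u : R * R))%R *
    radial_kernel s r))%:E.

Lemma chord_kernel_ge0 u z t r : 0 <= chord_kernel u z t r.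
Proof.
rewrite lee_fin; apply: mulr_ge0; first by rewrite indicE.
by apply: mulr_ge0; [rewrite indicE|exact: radial_kernel_ge0].
Qed.

Lemma measurable_ray d (T : measurableType d) (u z : T -> M2) (t : T -> RM) :
  measurable_fun setT u -> measurable_fun setT z -> measurable_fun setT t ->
  measurable_fun setT
    (fun x => ((z x : R * R) + t x *: (u x : R * R))%R : M2).
Proof.
move=> mu' mz mt.
apply: (@measurable_fun_pair _ _ _ T RM RM (fun x => (z x).1 + t x * (u x).1)%R
   (fun x => (z x).2 + t x * (u x).2)%R).
  apply: measurable_funD; first exact: (measurableT_comp measurable_fst mz).
  apply: measurable_funM => //; exact: (measurableT_comp measurable_fst mu').
apply: measurable_funD; first exact: (measurableT_comp measurable_snd mz).
apply: measurable_funM => //; exact: (measurableT_comp measurable_snd mu').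
Qed.

Lemma measurable_chord_kernel d (T : measurableType d) (u z : T -> M2)
    (t r : T -> RM) :
  measurable_fun setT u -> measurable_fun setT z -> measurable_fun setT t ->
  measurable_fun setT r ->
  measurable_fun setT (fun x => chord_kernel (u x) (z x) (t x) (r x)).
Proof.
move=> mu' mz mt mr; apply/measurable_EFinP.
have mO : measurable (Omega : set M2) by exact: open_measurable2.
apply: measurable_funM.
  apply: (@measurableT_comp _ _ _ _ _ _ (\1_Omega : M2 -> R)).
    exact: measurable_indic.
  exact: measurable_ray.
apply: measurable_funM; last first.
  exact: (measurableT_comp (measurable_radial_kernel s)).
apply: (@measurableT_comp _ _ _ _ _ _ (\1_(~` Omega) : M2 -> R)).
  by apply: measurable_indic; exact: measurableC.
apply: measurable_ray => //.
exact: measurable_funD.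
Qed.

Definition chord_energy (u z : M2) : \bar R :=
  \int[mu]_t \int[mu]_r chord_kernel u z t r.

Lemma chord_energy_ge0 u z : 0 <= chord_energy u z.
Proof.
apply: integral_ge0 => t _; apply: integral_ge0 => r _.
exact: chord_kernel_ge0.
Qed.

Lemma chord_energyE u z : chord_energy u z =
  \int[mu]_(t in slice Omega u z) exit_integral s (slice Omega u z) t.
Proof.
rewrite [RHS]integral_mkcond; apply: eq_integral => t _; rewrite patchE.
rewrite /chord_kernel indicE.
have -> : (t \in slice Omega u z) =
  (((z : R * R) + t *: (u : R * R))%R \in Omega) by [].
case: ifPn => _; last by rewrite integral0_eq// => r _; rewrite mul0r.
by apply: eq_integral => r _; rewrite mul1r.
Qed.

Lemma measurable_chord_energy d (T : measurableType d) (u z : T -> M2) :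
  measurable_fun setT u -> measurable_fun setT z ->
  measurable_fun setT (fun x => chord_energy (u x) (z x)).
Proof.
move=> mu' mz.
apply: (@measurable_integral_param _ _ _
  (fun x t => \int[mu]_r chord_kernel (u x) (z x) t r)).
  apply: (@measurable_integral_param _ _ _
    (fun v r => chord_kernel (u v.1) (z v.1) v.2 r)).
    apply: measurable_chord_kernel.
    - apply: (measurableT_comp mu').
      exact: (measurableT_comp measurable_fst measurable_fst).
    - apply: (measurableT_comp mz).
      exact: (measurableT_comp measurable_fst measurable_fst).
    - exact: (measurableT_comp measurable_snd measurable_fst).
    - exact: measurable_snd.
  by move=> v r; exact: chord_kernel_ge0.
by move=> x t; apply: integral_ge0 => r _; exact: chord_kernel_ge0.
Qed.

End fixed_set.

Lemma measurable_enorm : measurable_fun setT (@enorm R : M2 -> R).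
Proof.
apply: (@measurableT_comp _ _ _ _ _ _ (@Num.sqrt R)).
  by apply: continuous_measurable_fun; exact: sqrt_continuous.
by apply: measurable_funD; apply: measurable_funM.
Qed.

Lemma enormN (v : R * R) : enorm (- v)%R = enorm v.
Proof. by rewrite /enorm /dot /= !mulrNN. Qed.

Lemma enorm_polar (r t : R) : (0 <= r)%R -> enorm (r * cos t, r * sin t)%R = r.
Proof.
move=> r0; rewrite /enorm /dot /= -!expr2 !exprMn -mulrDr cos2Dsin2 mulr1.
by rewrite sqrtr_sqr ger0_norm.
Qed.

Section perimeter.
Variables (s : R) (Omega : set (R * R)).
Hypothesis oO : open Omega.

Let mO : measurable (Omega : set M2) := open_measurable2 oO.

Let interaction (x h : M2) : \bar R :=
  (\1_Omega x * (\1_(~` Omega) ((x : R * R) + (h : R * R))%R *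
    (enorm h `^ (2 + s))^-1))%:E.

Let interaction_ge0 x h : 0 <= interaction x h.
Proof.
rewrite lee_fin; apply: mulr_ge0; first by rewrite indicE.
by apply: mulr_ge0; [rewrite indicE|rewrite invr_ge0 powR_ge0].
Qed.

Let measurable_interaction d (T : measurableType d) (x h : T -> M2) :
  measurable_fun setT x -> measurable_fun setT h ->
  measurable_fun setT (fun v => interaction (x v) (h v)).
Proof.
move=> mx mh; apply/measurable_EFinP.
apply: measurable_funM.
  apply: (@measurableT_comp _ _ _ _ _ _ (\1_Omega : M2 -> R)) => //.
apply: measurable_funM.
  apply: (@measurableT_comp _ _ _ _ _ _ (\1_(~` Omega) : M2 -> R)).
    by apply: measurable_indic; exact: measurableC.
  apply: (@measurable_fun_pair _ _ _ T RM RM (fun v => (x v).1 + (h v).1)%R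
    (fun v => (x v).2 + (h v).2)%R); apply: measurable_funD.
  - exact: (measurableT_comp measurable_fst mx).
  - exact: (measurableT_comp measurable_fst mh).
  - exact: (measurableT_comp measurable_snd mx).
  - exact: (measurableT_comp measurable_snd mh).
apply: (measurableT_comp measurable_inv).
apply: (measurableT_comp (@measurable_powR _ _)).
exact: (measurableT_comp measurable_enorm mh).
Qed.

(** Substituting y = x + h makes the kernel a function of h alone. *)
Let perimeter_translation : frac_perimeter s Omega =
  \int[@lebesgue2 R]_h \int[@lebesgue2 R]_x interaction x h.
Proof.
have -> : \int[@lebesgue2 R]_h \int[@lebesgue2 R]_x interaction x h =
    \int[@lebesgue2 R]_x \int[@lebesgue2 R]_h interaction x h.
  exact/esym/(@fubini_tonelli _ _ M2 M2 R (@lebesgue2 R) (@lebesgue2 R)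
    (fun v => interaction v.1 v.2)
    (measurable_interaction measurable_fst measurable_snd)
    (fun v => interaction_ge0 v.1 v.2)).
rewrite /frac_perimeter integral_mkcond; apply: eq_integral => x _.
rewrite patchE; case: ifPn => xO; last first.
  rewrite integral0_eq// => h _.
  by rewrite /interaction indicE (negbTE xO) mul0r.
rewrite [LHS]integral_mkcond [LHS](@ge0_integral_translation _ _ x).
- apply: eq_integral => h _.
  rewrite patchE /interaction indicE xO mul1r indicE.
  have -> : ((x.1 + h.1, x.2 + h.2)%R \in ~` Omega) =
     (((x : R * R) + (h : R * R))%R \in ~` Omega) by [].
  case: ifP => _; last by rewrite mul0r.
  rewrite mul1r -enormN; congr ((enorm _ `^ _)^-1)%:E.
  have -> : ((x.1 + h.1, x.2 + h.2) = (x : R * R) + (h : R * R))%R by [].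
  by rewrite opprB addrC addKr.
- apply/(measurable_restrictT _ _).1; first exact: measurableC.
  apply: measurable_funTS; apply/measurable_EFinP.
  apply: (measurableT_comp measurable_inv).
  apply: (measurableT_comp (@measurable_powR _ _)).
  apply: (measurableT_comp measurable_enorm).
  by apply: measurable_fun_pair; apply: measurable_funB.
- by move=> v; apply: erestrict_ge0 => y _; rewrite lee_fin invr_ge0 powR_ge0.
Qed.

Let radial_factor (r t : R) :
  (Num.max r 0 * (enorm (r * cos t, r * sin t)%R `^ (2 + s))^-1)%R =
  radial_kernel s r.
Proof.
rewrite /radial_kernel indicE mem_setE in_itv/= andbT.
have [r0|r0] := ltP 0%R r; last by rewrite !mul0r.
rewrite enorm_polar ?(ltW r0)// mul1r -powRN -{1}(powRr1 (ltW r0)) -powRD.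
  by congr (_ `^ _)%R; ring.
by apply/implyP => _; rewrite gt_eqF.
Qed.

(** For h = r u with u a unit vector, the point x is described by its
    coordinate q orthogonal to u and its position a along u. *)
Let polar_interaction (t r : R) :
  polar_integrand (fun h => \int[@lebesgue2 R]_x interaction x h) t r =
  \int[mu]_q \int[mu]_a
    chord_kernel s Omega (cos t, sin t) (q * - sin t, q * cos t)%R a r.
Proof.
pose h : M2 := (r * cos t, r * sin t)%R.
have r0 : (0 <= Num.max r 0)%R by rewrite le_max lexx orbT.
pose f x : \bar R := (Num.max r 0)%:E * interaction x h.
have f0 x : 0 <= f x by rewrite mule_ge0// lee_fin.
have mih : measurable_fun setT (interaction ^~ h).
  exact: measurable_interaction.
have mf : measurable_fun setT f by exact: emeasurable_funM.
transitivity (\int[@lebesgue2 R]_x f x).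
  by rewrite /polar_integrand -ge0_integralZl_EFin.
rewrite (ge0_integral_rotation mf f0 (cos2Dsin2 t)).
apply: eq_integral => q _; apply: eq_integral => a _.
rewrite /f /interaction /chord_kernel -EFinM -(radial_factor r t); congr EFin.
rewrite mulrCA; congr (\1_Omega _ * _)%R.
rewrite mulrCA; congr (\1_(~` Omega) _ * _)%R.
rewrite -[LHS]/((q * - sin t + a * cos t + r * cos t,
  q * cos t + a * sin t + r * sin t)%R).
by rewrite -!addrA -!mulrDl.
Qed.

(** Polar coordinates are used for h, and the coordinates adapted to the
    direction of h for x. Exchanging the integrals then puts the distance r
    innermost, next to the position on the line. *)
Lemma frac_perimeter_chord_energy : frac_perimeter s Omega =
  \int[mu]_(t in `[0%R, (2 * pi)%R[) \int[mu]_q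
    chord_energy s Omega (cos t, sin t) (q * - sin t, q * cos t)%R.
Proof.
rewrite perimeter_translation ge0_integral_polar; first last.
- by move=> h; apply: integral_ge0 => x _; exact: interaction_ge0.
- exact: (@measurable_fun_fubini_tonelli_G _ _ M2 M2 R (@lebesgue2 R)
    (fun v => interaction v.1 v.2)
    (measurable_interaction measurable_fst measurable_snd)
    (fun v => interaction_ge0 v.1 v.2)).
apply: eq_integral => t _.
pose u : M2 := (cos t, sin t).
pose z (q : R) : M2 := (q * - sin t, q * cos t)%R.
pose f (r q a : R) := chord_kernel s Omega u (z q) a r.
have f0 r q a : 0 <= f r q a by exact: chord_kernel_ge0.
have mz d (T : measurableType d) (q : T -> RM) :
    measurable_fun setT q -> measurable_fun setT (fun x => z (q x)).
  move=> mq.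
  apply: (@measurable_fun_pair _ _ _ T RM RM (fun x => q x * - sin t)%R
    (fun x => q x * cos t)%R); exact: measurable_funM.
transitivity (\int[mu]_r \int[mu]_q \int[mu]_a f r q a).
  by apply: eq_integral => r _; exact: polar_interaction.
pose F r q := \int[mu]_a f r q a.
have F0 r q : 0 <= F r q by exact: integral_ge0.
have mF : jointly_measurable F.
  apply: (@measurable_integral_param _ _ _ (fun v a => f v.1 v.2 a)) => //.
  apply: measurable_chord_kernel => //.
  - apply: mz; exact: (measurableT_comp measurable_snd measurable_fst).
  - exact: (measurableT_comp measurable_fst measurable_fst).
transitivity (\int[mu]_q \int[mu]_r F r q); first exact: tonelli_swap.
apply: eq_integral => q _.
apply: (@tonelli_swap _ (fun r a => f r q a)) => //.
by apply: measurable_chord_kernel => //; exact: measurable_cst.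
Qed.

End perimeter.

End lines.

(** * Slices of open sets and of convex bodies *)

Section slices.
Context {R : realType}.
Implicit Types (Omega : set (R * R)) (u z : R * R).

Lemma slice_open Omega u z : open Omega -> open (slice Omega u z).
Proof.
move=> oO; apply: (@open_comp _ _ (fun t : R => z + t *: u)) => // t _.
apply: cvgD; first exact: cvg_cst.
exact: scalel_continuous.
Qed.

Lemma slice_bounded Omega u z : bounded_set Omega -> u != 0 ->
  has_lbound (slice Omega u z) /\ has_ubound (slice Omega u z).
Proof.
move=> [M [_ HM]] u0.
pose B := (`|M| + 1 + `|z|) / `|u|.
have tB t : slice Omega u z t -> `|t| <= B.
  move=> /HM => /(_ (`|M| + 1)) ztM; rewrite ler_pdivlMr ?normr_gt0//.
  rewrite -normrZ -[X in `|X|](addKr z) (le_trans (ler_normD _ _))//.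
  rewrite normrN addrC lerD2r ztM//.
  by rewrite (le_lt_trans (ler_norm _))// ltrDl.
split; [exists (- B)|exists B] => t /tB; rewrite ler_norml => /andP[] //.
Qed.

(** The homothety of centre y and ratio l maps the ball of radius e around x
    onto the ball of radius l e around l x + (1 - l) y, and it maps K into
    K. *)
Lemma interior_convex (K : set (R * R)) (x y : R * R) (l : R) :
  convex_set (K : set (convex_lmodType (R * R)%type)) ->
  K° x -> K y -> 0 < l -> l <= 1 -> K° (l *: x + (1 - l) *: y).
Proof.
move=> cK /nbhs_ballP[e /= e0 eK] Ky l0 l1.
apply/nbhs_ballP; exists (l * e) => /=; first by rewrite mulr_gt0.
move=> w; rewrite -ball_normE /= => pw.
pose x' := x + l^-1 *: (w - (l *: x + (1 - l) *: y)).
have Kx' : K x'.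
  apply: eK; rewrite -ball_normE /= /x' opprD addrA subrr sub0r normrN normrZ.
  rewrite ger0_norm ?invr_ge0 ?(ltW l0)// ltr_pdivrMl//.
  by rewrite distrC.
have -> : w = l *: x' + (1 - l) *: y.
  rewrite /x' scalerDr scalerA mulfV ?gt_eqF// scale1r.
  by rewrite addrAC addrC subrK.
have := cK x' y (Itv01 (ltW l0) l1) (mem_set Kx') (mem_set Ky).
by move/set_mem.
Qed.

Lemma slice_interior_convex (K : set (R * R)) u z :
  convex_set (K : set (convex_lmodType (R * R)%type)) ->
  is_interval (slice K° u z).
Proof.
move=> cK; apply/is_intervalPlt => a b Ka Kb t /andP[at_ tb].
have ab : 0 < b - a by rewrite subr_gt0 (lt_trans at_).
pose l := (b - t) / (b - a).
have l0 : 0 < l by rewrite divr_gt0// subr_gt0.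
have l1 : l <= 1 by rewrite ler_pdivrMr// mul1r lerD2l lerN2 ltW.
have := interior_convex cK Ka (interior_subset Kb) l0 l1.
rewrite /slice /=; congr (K° _).
rewrite !scalerDr !scalerA addrACA -!scalerDl; congr (_ + _ *: _).
  by rewrite addrC subrK scale1r.
by rewrite /l; field; rewrite gt_eqF.
Qed.

End slices.

(** * The chord functional as an integral over lines *)

Section chord.
Context {R : realType}.
Notation mu := (@lebesgue_measure R).
Local Open Scope ereal_scope.
Notation RM := (measurableTypeR R).
Notation M2 := (measurableTypeR R * measurableTypeR R)%type.

Let polar_angle : RM -> M2 := fun t => (cos t, sin t).

Let measurable_polar_angle : measurable_fun setT polar_angle.
Proof.
apply: (@measurable_fun_pair _ _ _ RM RM RM (@cos R) (@sin R)).
  exact: measurable_cosR.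
exact: measurable_sinR.
Qed.

Let line_param (u : M2) : RM -> M2 := fun q => (q * - u.2, q * u.1)%R.

Let measurable_line_param u : measurable_fun setT (line_param u).
Proof.
apply: (@measurable_fun_pair _ _ _ RM RM RM (fun q => q * - u.2)%R
  (fun q => q * u.1)%R); exact: measurable_funM.
Qed.

(** The set functions arclength and orthogonal_line_measure are convertible
    to the two measures below, which carry the proofs of sigma-additivity. *)
Let arclengthM : {measure set M2 -> \bar R} :=
  image_measure (mrestr mu (measurable_itv `[0%R, (2 * pi)%R[))
    measurable_polar_angle.

Let orthogonal_lineM (u : M2) : {measure set M2 -> \bar R} :=
  image_measure mu (measurable_line_param u).

Let measurable_dot (u : M2) : measurable_fun setT (fun z : M2 => dot z u).
Proof. by apply: measurable_funD; apply: measurable_funM. Qed.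

Lemma measurable_orthogonal_line (u : M2) :
  measurable (orthogonal_line u : set M2).
Proof.
rewrite -[X in measurable X]setTI.
exact: (measurable_dot u measurableT (measurable_set1 0%R)).
Qed.

Lemma measurable_unit_circle : measurable (@unit_circle R : set M2).
Proof.
rewrite -[X in measurable X]setTI.
exact: (@measurable_enorm R measurableT _ (measurable_set1 1%R)).
Qed.

Lemma ge0_integral_orthogonal_line (u : M2) (f : M2 -> \bar R) :
  measurable_fun setT f -> (forall z, 0 <= f z) ->
  \int[orthogonal_line_measure u]_(z in orthogonal_line u) f z =
  \int[mu]_q f (q * - u.2, q * u.1)%R.
Proof.
move=> mf f0.
rewrite (ge0_integral_pushforward (measurable_line_param u))//.
- congr integral; apply/seteqP; split => // q _ /=.
  by rewrite /orthogonal_line /dot /=; ring.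
- exact: measurable_orthogonal_line.
- exact: measurable_funTS.
Qed.

Lemma ge0_integral_arclength (f : M2 -> \bar R) :
  measurable_fun setT f -> (forall u, 0 <= f u) ->
  \int[@arclength R]_(u in @unit_circle R) f u =
  \int[mu]_(t in `[0%R, (2 * pi)%R[) f (cos t, sin t).
Proof.
move=> mf f0.
rewrite (ge0_integral_pushforward measurable_polar_angle)//.
- have -> : polar_angle @^-1` (@unit_circle R) = setT.
    apply/seteqP; split => // t _ /=.
    by rewrite /unit_circle /enorm /dot /= -!expr2 cos2Dsin2 sqrtr1.
  rewrite (@ge0_integral_density _ _ RM mu _
    (\1_(`[0%R, (2 * pi)%R[%classic : set RM)))//.
  + rewrite [RHS]integral_mkcond; apply: eq_integral => t _.
    rewrite patchE indicE; case: ifPn => _; first by rewrite mule1.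
    by rewrite mule0.
  + move=> A mA; rewrite integral_indic//.
    by rewrite /mrestr setIC.
  + exact: (measurableT_comp mf measurable_polar_angle).
  + by move=> t; exact: f0.
- exact: measurable_unit_circle.
- exact: measurable_funTS.
Qed.

Section chord_functional.
Variables (s : R) (Omega : set (R * R)).
Hypotheses (oO : open Omega) (bO : bounded_set Omega).
Hypotheses (s0 : (0 < s)%R) (s1 : (s < 1)%R).

Let K := (s * (1 - s))%R.
Let K0 : (0 < K)%R. Proof. by rewrite mulr_gt0// subr_gt0. Qed.

(** Normalized so as to bound the sum over the chords of the line from
    below. *)
Let energy_density (u z : M2) : \bar R := K%:E * chord_energy s Omega u z.

Let chord_sum (u z : M2) : \bar R :=
  \esum_(J in interval_components (slice Omega u z)) poweR (mu J) (1 - s).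

Let energy_density_ge0 u z : 0 <= energy_density u z.
Proof. by rewrite mule_ge0 ?lee_fin ?(ltW K0)// chord_energy_ge0. Qed.

Let unit_vector_neq0 (u : M2) : unit_circle u -> (u : R * R) != 0%R.
Proof.
move=> u1; apply/eqP => u0; move: u1; rewrite u0 /unit_circle /enorm /dot /=.
by rewrite !mul0r addr0 sqrtr0 => /eqP; rewrite eq_sym oner_eq0.
Qed.

Let energy_density_le u z :
  unit_circle u -> energy_density u z <= chord_sum u z.
Proof.
move=> /unit_vector_neq0 u0; have [lb ub] := slice_bounded z bO u0.
rewrite /energy_density chord_energyE.
by apply: exit_integral_le_chord_sum => //; exact: slice_open.
Qed.

Let energy_densityE u z : unit_circle u -> is_interval (slice Omega u z) ->
  energy_density u z = chord_sum u z.
Proof.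
move=> /unit_vector_neq0 u0 iS; have [lb ub] := slice_bounded z bO u0.
rewrite /energy_density chord_energyE.
by apply: exit_integral_interval => //; exact: slice_open.
Qed.

(** Since the energy density is measurable in u and z, its integrals against
    arclength and against the measures of the lines can be computed in the
    parameters t and q, and these are the parameters of the expression of
    the perimeter. *)
Let integral_energy_density :
  \int[@arclength R]_(u in @unit_circle R)
    \int[orthogonal_line_measure u]_(z in orthogonal_line u) energy_density u z
  = K%:E * frac_perimeter s Omega.
Proof.
have mE d (T : measurableType d) (u z : T -> M2) :
    measurable_fun setT u -> measurable_fun setT z ->
    measurable_fun setT (fun x => chord_energy s Omega (u x) (z x)).
  exact: measurable_chord_energy.
have mD (u : M2) : measurable_fun setT (energy_density u).
  by apply: emeasurable_funM => //; apply: mE => //; exact: measurable_cst.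
pose F (u : M2) := \int[mu]_q chord_energy s Omega u (q * - u.2, q * u.1)%R.
have F0 u : 0 <= F u by apply: integral_ge0 => q _; exact: chord_energy_ge0.
have mFq (u : M2) : measurable_fun [set: RM]
    (fun q : RM => chord_energy s Omega u (q * - u.2, q * u.1)%R).
  by apply: mE; [exact: measurable_cst|exact: measurable_line_param].
have mF : measurable_fun setT F.
  apply: (@measurable_integral_param _ _ _
    (fun u q => chord_energy s Omega u (q * - u.2, q * u.1)%R)).
    apply: mE; first exact: measurable_fst.
    apply: (@measurable_fun_pair _ _ _ _ RM RM
      (fun v : M2 * RM => v.2 * - v.1.2)%R (fun v : M2 * RM => v.2 * v.1.1)%R).
      apply: measurable_funM; first exact: measurable_snd.
      apply: measurableT_comp => //.
      exact: (measurableT_comp measurable_snd measurable_fst).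
    apply: measurable_funM; first exact: measurable_snd.
    exact: (measurableT_comp measurable_fst measurable_fst).
  by move=> u q; exact: chord_energy_ge0.
transitivity (\int[@arclength R]_(u in @unit_circle R) (K%:E * F u)).
  apply: (@eq_integral _ M2 R arclengthM) => u _.
  rewrite (ge0_integral_orthogonal_line u (mD u) (energy_density_ge0 u)).
  apply: (@ge0_integralZl_EFin _ RM R mu setT measurableT _ _ (mFq u)
    K (ltW K0)).
  by move=> q _; exact: chord_energy_ge0.
rewrite ge0_integral_arclength.
- rewrite (frac_perimeter_chord_energy s oO).
  apply: (@ge0_integralZl_EFin _ RM R mu _ _ (fun t => F (polar_angle t)) _ _
    K (ltW K0)).
  + exact: measurable_itv.
  + by move=> t _; exact: F0.
  + apply: measurable_funTS; apply: (measurableT_comp mF).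
    exact: measurable_polar_angle.
- by apply: emeasurable_funM.
- by move=> u; rewrite mule_ge0 ?lee_fin// ltW.
Qed.

Lemma frac_perimeter_le_chord_functional :
  K%:E * frac_perimeter s Omega <= chord_functional (1 - s) Omega.
Proof.
rewrite -integral_energy_density.
apply: (@le_integral_ge0 _ _ _ arclengthM) => u u1.
  apply: (@integral_ge0 _ M2 R (orthogonal_lineM u)) => z _.
  exact: energy_density_ge0.
apply: (@le_integral_ge0 _ _ _ (orthogonal_lineM u)) => z _.
  exact: energy_density_ge0.
exact: energy_density_le.
Qed.

Lemma frac_perimeter_eq_chord_functional :
  (forall u z, is_interval (slice Omega u z)) ->
  K%:E * frac_perimeter s Omega = chord_functional (1 - s) Omega.
Proof.
move=> iS; rewrite -integral_energy_density.
apply: (@eq_integral _ M2 R arclengthM) => u /set_mem u1.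
apply: (@eq_integral _ M2 R (orthogonal_lineM u)) => z _.
exact: energy_densityE.
Qed.

End chord_functional.

End chord.

(** * The inequality and the case of convex bodies *)

Theorem proposition2p1 (R : realType) (Omega : set (R * R)) (s : R)
    (Omega_open : open Omega) (Omega_bounded : bounded_set Omega)
    (s_gt0 : 0 < s) (s_lt1 : s < 1) :
  (frac_perimeter s Omega <=
     (1 / (s * (1 - s)))%:E * chord_functional (1 - s) Omega)%E /\
  (forall K : set (R * R), planar_convex_body K -> Omega = K° ->
     frac_perimeter s Omega =
       ((1 / (s * (1 - s)))%:E * chord_functional (1 - s) Omega)%E).
Proof.
have K0 : 0 < s * (1 - s) by rewrite mulr_gt0// subr_gt0.
have PE : frac_perimeter s Omega =
    ((1 / (s * (1 - s)))%:E * ((s * (1 - s))%:E * frac_perimeter s Omega))%E.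
  by rewrite muleA -EFinM div1r mulVf ?gt_eqF// mul1e.
split=> [|K [_ cK _] OmegaK]; rewrite PE.
  rewrite lee_wpmul2l//.
    by rewrite lee_fin divr_ge0// ltW.
  exact: frac_perimeter_le_chord_functional.
congr (_ * _)%E; apply: frac_perimeter_eq_chord_functional => // u z.
by rewrite OmegaK; exact: slice_interior_convex.
Qed.
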